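(* For all $\Sigma\cup\{\alpha\}\subseteq\mathit{Fm}$, if $\Sigma\vdash_{\mathrm{HPRL}^{re}}\alpha$ then $\Sigma\models_{\mathrm{PPRL}}\alpha$.
   Context: Language $\mathcal{L}=\{\land,\lor,\longrightarrow,\neg,I,C,0,1\}$ with arities $2,2,2,1,1,1,0,0$; $\mathit{Fm}$ is the set of formulas over a countably infinite set $V$ of variables; $\mathrm{var}(\varphi)$ is the set of variables of $\varphi$. $\mathrm{HPRL}^{re}$ is the Hilbert-style logic (derivations from hypotheses $\Sigma$ are finite sequences of axiom instances, hypotheses and rule applications) with axiom schemes: (A1) $\alpha\longrightarrow\neg\neg\alpha$; (A2) $\neg\neg\alpha\longrightarrow\alpha$; (A3) $(\alpha\land\beta)\longrightarrow\beta$; (A4) $(\alpha\land\beta)\longrightarrow(\beta\land\alpha)$; (A5) $(\alpha\land(\beta\lor\gamma))\longrightarrow((\alpha\land\beta)\lor(\alpha\land\gamma))$; (A6) $((\alpha\land\beta)\lor(\alpha\land\gamma))\longrightarrow(\alpha\land(\beta\lor\gamma))$; (A7) $(\alpha\lor\beta)\longrightarrow\neg(\neg\alpha\land\neg\beta)$; (A8) $\neg(\neg\alpha\land\neg\beta)\longrightarrow(\alpha\lor\beta)$; (A9) $C\alpha\longrightarrow\neg I\neg\alpha$; (A10) $\neg I\neg\alpha\longrightarrow C\alpha$; (A11) $I\alpha\longrightarrow\alpha$; (A12) $(I\alpha\land I\beta)\longrightarrow I(\alpha\land\beta)$; (A13) $(\alpha\longrightarrow\beta)\longrightarrow((\neg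 I\alpha\lor I\beta)\land(\neg C\alpha\lor C\beta))$; (A14) $((\neg I\alpha\lor I\beta)\land(\neg C\alpha\lor C\beta))\longrightarrow(\alpha\longrightarrow\beta)$; and rules: (R1$'$) from $\alpha$ and $\alpha\longrightarrow\beta$ infer $\beta$, provided $\mathrm{var}(\alpha)\subseteq\mathrm{var}(\beta)$; (R2$'$) from $\alpha\longrightarrow\beta$ and $\beta\longrightarrow\gamma$ infer $\alpha\longrightarrow\gamma$, provided $\mathrm{var}(\beta)\subseteq\mathrm{var}(\alpha)\cup\mathrm{var}(\gamma)$; (R3) from $\alpha$ infer $\beta\longrightarrow\alpha$; (R4) from $\alpha\longrightarrow\beta$ infer $\neg\beta\longrightarrow\neg\alpha$; (R5) from $\alpha\longrightarrow\beta$, $\alpha\longrightarrow\gamma$ infer $\alpha\longrightarrow(\beta\land\gamma)$; (R6) from $\alpha\longrightarrow\beta$, $\beta\longrightarrow\alpha$, $\gamma\longrightarrow\delta$, $\delta\longrightarrow\gamma$ infer $(\alpha\longrightarrow\gamma)\longrightarrow(\beta\longrightarrow\delta)$; (R7) from $\alpha\longrightarrow\beta$ infer $I\alpha\longrightarrow I\beta$; (R8) from $\alpha$ infer $I\alpha$; (R9) from $I\alpha\longrightarrow I\beta$ and $C\alpha\longrightarrow C\beta$ infer $\alpha\longrightarrow\beta$. A pre-rough algebra is an $\mathcal{L}$-algebra $\mathbf{R}$ (universe $R$) whose $\{\land,\lor,\neg,0,1\}$-reduct is a quasi-Boolean algebra (bounded distributive lattice with $\neg\neg a=a$, $\neg(a\lor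 b)=\neg a\land\neg b$) and such that for all $a,b$: $I1=1$; $I(a\land b)=Ia\land Ib$; $\neg Ia\lor Ia=1$; $Ia\longrightarrow a=1$; $Ca=\neg I\neg a$; $a\longrightarrow b=(\neg Ia\lor Ib)\land(\neg Ca\lor Cb)$; $Ca\longrightarrow Cb=1$ and $Ia\longrightarrow Ib=1$ imply $a\longrightarrow b=1$. $\mathbf{R}^\#$ has universe $R\cup\{\omega\}$ ($\omega\notin R$), constants as in $\mathbf{R}$, operations of arity $\ge1$ agreeing with $\mathbf{R}$ on $R$ and returning $\omega$ if some argument is $\omega$. $\Sigma\models_{\mathrm{PPRL}}\alpha$ iff for every pre-rough algebra $\mathbf{R}$ and homomorphism $v^\#:\mathbf{Fm}\to\mathbf{R}^\#$, $v^\#[\Sigma]\subseteq\{1,\omega\}$ implies $v^\#(\alpha)\in\{1,\omega\}$.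
   Formalization: Pre-rough algebras are additionally required to satisfy: a→b=1 implies a≤b. Without it the claim fails (two-element Boolean algebra with I constantly 1, so C is constantly 0 and → constantly 1, refutes R1′); with it, ''→ = 1'' expresses the lattice order, as intended. *)

(* Defs.v *)
From HB Require Import structures.
From mathcomp Require Import all_boot.

Set Implicit Arguments.
Unset Strict Implicit.
Unset Printing Implicit Defensive.

Declare Scope fm_scope.
Delimit Scope fm_scope with fm.
Declare Scope alg_scope.
Delimit Scope alg_scope with alg.

(* Formulas; the countably infinite set of variables is nat. *)

Inductive fm : Type :=
| Var of nat
| And of fm & fm
| Or of fm & fm
| Imp of fm & fm
| Neg of fm
| Int of fm
| Clo of fm
| Zero
| One.

Bind Scope fm_scope with fm.

Notation "a && b" := (And a b) : fm_scope.
Notation "a || b" := (Or a b) : fm_scope.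
Notation "a ==> b" := (Imp a b) : fm_scope.
Notation "~~ a" := (Neg a) : fm_scope.

Lemma fm_comparable : comparable fm.
Proof. by move=> a b; rewrite /decidable; decide equality; apply: eq_comparable. Qed.

HB.instance Definition _ := hasDecEq.Build fm (compareP fm_comparable).

(* The members of this sequence form the set var(a). *)
Fixpoint var (a : fm) : seq nat :=
  match a with
  | Var x => [:: x]
  | And a b | Or a b | Imp a b => var a ++ var b
  | Neg a | Int a | Clo a => var a
  | Zero | One => [::]
  end.

Section HPRLre.

Local Open Scope fm_scope.

Inductive axiom : fm -> Prop :=
| A1 a : axiom (a ==> ~~ ~~ a)
| A2 a : axiom (~~ ~~ a ==> a)
| A3 a b : axiom ((a && b) ==> b)
| A4 a b : axiom ((a && b) ==> (b && a))
| A5 a b c : axiom ((a && (b || c)) ==> ((a && b) || (a && c)))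
| A6 a b c : axiom (((a && b) || (a && c)) ==> (a && (b || c)))
| A7 a b : axiom ((a || b) ==> ~~ (~~ a && ~~ b))
| A8 a b : axiom (~~ (~~ a && ~~ b) ==> (a || b))
| A9 a : axiom (Clo a ==> ~~ Int (~~ a))
| A10 a : axiom (~~ Int (~~ a) ==> Clo a)
| A11 a : axiom (Int a ==> a)
| A12 a b : axiom ((Int a && Int b) ==> Int (a && b))
| A13 a b :
    axiom ((a ==> b) ==> ((~~ Int a || Int b) && (~~ Clo a || Clo b)))
| A14 a b :
    axiom (((~~ Int a || Int b) && (~~ Clo a || Clo b)) ==> (a ==> b)).

(* [rule ps c]: the conclusion c is inferred from the premises ps. *)
Inductive rule : seq fm -> fm -> Prop :=
| R1' a b : {subset var a <= var b} -> rule [:: a; a ==> b] b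
| R2' a b c : {subset var b <= var a ++ var c} ->
    rule [:: a ==> b; b ==> c] (a ==> c)
| R3 a b : rule [:: a] (b ==> a)
| R4 a b : rule [:: a ==> b] (~~ b ==> ~~ a)
| R5 a b c : rule [:: a ==> b; a ==> c] (a ==> (b && c))
| R6 a b c d :
    rule [:: a ==> b; b ==> a; c ==> d; d ==> c] ((a ==> c) ==> (b ==> d))
| R7 a b : rule [:: a ==> b] (Int a ==> Int b)
| R8 a : rule [:: a] (Int a)
| R9 a b : rule [:: Int a ==> Int b; Clo a ==> Clo b] (a ==> b).

Definition derivation (Sigma : fm -> Prop) (s : seq fm) : Prop :=
  forall i, i < size s ->
    let a := nth Zero s i in
    [\/ axiom a, Sigma a |
        exists2 ps, {subset ps <= take i s} & rule ps a].

Definition HPRLre_derives (Sigma : fm -> Prop) (a : fm) : Prop :=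
  exists s, derivation Sigma (rcons s a).

End HPRLre.

Record algebra : Type := Algebra {
  carrier :> Type;
  meet : carrier -> carrier -> carrier;
  join : carrier -> carrier -> carrier;
  imp : carrier -> carrier -> carrier;
  neg : carrier -> carrier;
  int_op : carrier -> carrier;
  clo_op : carrier -> carrier;
  alg0 : carrier;
  alg1 : carrier
}.

Arguments alg0 {_}.
Arguments alg1 {_}.

Notation "x && y" := (meet x y) : alg_scope.
Notation "x || y" := (join x y) : alg_scope.
Notation "x ==> y" := (imp x y) : alg_scope.
Notation "~~ x" := (neg x) : alg_scope.
Notation "0" := alg0 : alg_scope.
Notation "1" := alg1 : alg_scope.

Record homomorphism (A B : algebra) (f : A -> B) : Prop := Homomorphism {
  hom_meet : {morph f : x y / meet x y};
  hom_join : {morph f : x y / join x y};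
  hom_imp : {morph f : x y / imp x y};
  hom_neg : {morph f : x / neg x};
  hom_int : {morph f : x / int_op x};
  hom_clo : {morph f : x / clo_op x};
  hom_zero : f alg0 = alg0;
  hom_one : f alg1 = alg1
}.

Definition Fm : algebra := Algebra And Or Imp Neg Int Clo Zero One.

Section PreRough.

Local Open Scope alg_scope.

Record quasi_boolean (R : algebra) : Prop := QuasiBoolean {
  qb_meetC : commutative (@meet R);
  qb_joinC : commutative (@join R);
  qb_meetA : associative (@meet R);
  qb_joinA : associative (@join R);
  qb_joinK : forall a b : R, a && (a || b) = a;
  qb_meetK : forall a b : R, a || (a && b) = a;
  qb_distr : right_distributive (@meet R) (@join R);
  qb_bottom : forall a : R, 0 && a = 0;
  qb_top : forall a : R, a && 1 = a;
  qb_negK : involutive (@neg R);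
  qb_neg_join : forall a b : R, ~~ (a || b) = ~~ a && ~~ b
}.

(* [pr_imp_le] makes explicit that an equation "a ==> b = 1" below expresses
   the lattice order "a <= b" (the converse implication follows from the other
   clauses).  Given this clause, [pr_int_le] says "I a <= a" and [pr_imp_intro]
   says that "C a <= C b" and "I a <= I b" imply "a <= b".  It cannot be
   dropped: without it the two-element Boolean algebra with I constantly 1
   and C constantly 0, hence with a ==> b = 1 for all a and b, satisfies every
   other clause, and modus ponens is unsound there. *)
Record pre_rough (R : algebra) : Prop := PreRough {
  pr_quasi_boolean :> quasi_boolean R;
  pr_int1 : int_op 1 = 1 :> R;
  pr_int_meet : forall a b : R, int_op (a && b) = int_op a && int_op b;
  pr_int_compl : forall a : R, ~~ int_op a || int_op a = 1;
  pr_int_le : forall a : R, int_op a ==> a = 1;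
  pr_clo : forall a : R, clo_op a = ~~ int_op (~~ a);
  pr_imp : forall a b : R,
    a ==> b = (~~ int_op a || int_op b) && (~~ clo_op a || clo_op b);
  pr_imp_intro : forall a b : R,
    clo_op a ==> clo_op b = 1 -> int_op a ==> int_op b = 1 -> a ==> b = 1;
  pr_imp_le : forall a b : R, a ==> b = 1 -> a && b = a
}.

End PreRough.

(* The algebra R^#, where [None] is the additional absorbing element omega. *)
Section Sharp.

Variable R : algebra.

Definition lift1 (f : R -> R) (x : option R) : option R := omap f x.

Definition lift2 (f : R -> R -> R) (x y : option R) : option R :=
  if x is Some a then if y is Some b then Some (f a b) else None else None.

Definition sharp : algebra :=
  Algebra (lift2 (@meet R)) (lift2 (@join R)) (lift2 (@imp R))
    (lift1 (@neg R)) (lift1 (@int_op R)) (lift1 (@clo_op R))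
    (Some alg0) (Some alg1).

Definition designated (x : sharp) : Prop := x = Some alg1 \/ x = None.

End Sharp.

Definition PPRL_entails (Sigma : fm -> Prop) (a : fm) : Prop :=
  forall R : algebra, pre_rough R ->
  forall v : Fm -> sharp R, homomorphism v ->
    (forall s, Sigma s -> designated (v s)) -> designated (v a).

(* Main.v *)
Require Import Defs.
From mathcomp Require Import all_boot.

Set Implicit Arguments.
Unset Strict Implicit.
Unset Printing Implicit Defensive.

(** In a pre-rough algebra the equation [a ==> b = 1] defines the lattice order,
so every axiom and rule preserves the value [1] as long as all the formulas
involved have values in [R].  Since [omega] is absorbing, a formula takes the
value [omega] exactly when one of its variables does; the variable inclusions
in R1' and R2' therefore guarantee that, when the conclusion has a value in [R],
so do the premises. *)

Section PreRoughOrder.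

Variables (R : algebra) (prR : pre_rough R).
Implicit Types a b c : R.

Local Open Scope alg_scope.

Lemma pr_meetxx a : a && a = a.
Proof. by rewrite -{2}(qb_meetK prR a a) (qb_joinK prR). Qed.

Lemma pr_join1 a : 1 || a = 1.
Proof. by rewrite -{1}(qb_top prR a) (qb_meetC prR a) (qb_meetK prR). Qed.

Lemma pr_le_join a b : a && b = a -> a || b = b.
Proof.
by move=> <-; rewrite (qb_joinC prR) (qb_meetC prR) (qb_meetK prR).
Qed.

Lemma pr_neg_anti a b : a && b = a -> ~~ b && ~~ a = ~~ b.
Proof.
move=> /pr_le_join ab.
by rewrite (qb_meetC prR) -(qb_neg_join prR) ab.
Qed.

(** Meant for complemented elements such as [int_op x] and [clo_op x], whose conjuncts in [pr_imp]
    have this shape. *)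
Lemma pr_compl_le a b : ~~ a || a = 1 -> a && b = a -> ~~ a || b = 1.
Proof.
by move=> a1 /pr_le_join <-; rewrite (qb_joinA prR) a1 pr_join1.
Qed.

Lemma pr_int_mono a b : a && b = a -> int_op a && int_op b = int_op a.
Proof. by rewrite -(pr_int_meet prR) => ->. Qed.

Lemma pr_clo_mono a b : a && b = a -> clo_op a && clo_op b = clo_op a.
Proof.
by rewrite !(pr_clo prR) => /pr_neg_anti/pr_int_mono/pr_neg_anti.
Qed.

(** From right to left, monotonicity of both modal operators and complementedness of their values
    make each conjunct in [pr_imp] equal to [1]. *)
Lemma pr_impP a b : a ==> b = 1 <-> a && b = a.
Proof.
split=> [/(pr_imp_le prR)//|ab].
rewrite (pr_imp prR) (pr_compl_le (pr_int_compl prR a) (pr_int_mono ab)).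
rewrite (pr_compl_le _ (pr_clo_mono ab)) ?pr_meetxx//.
(* The complement law for [clo_op a] is that for [int_op (~~ a)]. *)
by rewrite (pr_clo prR) (qb_negK prR) (qb_joinC prR) (pr_int_compl prR).
Qed.

Lemma pr_impxx a : a ==> a = 1.
Proof. exact/pr_impP/pr_meetxx. Qed.

Lemma pr_imp_trans a b c : a ==> b = 1 -> b ==> c = 1 -> a ==> c = 1.
Proof.
move=> /pr_impP ab /pr_impP bc; apply/pr_impP.
by rewrite -ab -(qb_meetA prR) bc.
Qed.

Lemma pr_imp_anti a b : a ==> b = 1 -> b ==> a = 1 -> a = b.
Proof.
by move=> /pr_impP ab /pr_impP ba; rewrite -ab (qb_meetC prR).
Qed.

Lemma pr_imp1x a : 1 ==> a = 1 -> a = 1.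
Proof. by move=> /pr_impP; rewrite (qb_meetC prR) (qb_top prR). Qed.

End PreRoughOrder.

Section Valuation.

Variables (R : algebra) (prR : pre_rough R).
Variables (v : Fm -> sharp R) (hv : homomorphism v).

(** The types unfold the operations of [Fm] and [sharp R], so that rewriting matches formulas and
    exposes the lifts. *)
Let vE :=
  (hom_meet hv : forall a b, v (And a b) = lift2 (@meet R) (v a) (v b),
   hom_join hv : forall a b, v (Or a b) = lift2 (@join R) (v a) (v b),
   hom_imp hv : forall a b, v (Imp a b) = lift2 (@imp R) (v a) (v b),
   hom_neg hv : forall a, v (Neg a) = lift1 (@neg R) (v a),
   hom_int hv : forall a, v (Int a) = lift1 (@int_op R) (v a),
   hom_clo hv : forall a, v (Clo a) = lift1 (@clo_op R) (v a),
   hom_zero hv : v Zero = Some alg0,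
   hom_one hv : v One = Some alg1).

Lemma isSome_val a : isSome (v a) = all (fun x => isSome (v (Var x))) (var a).
Proof.
elim: a => [x|a IHa b IHb|a IHa b IHb|a IHa b IHb|a IHa|a IHa|a IHa||] /=;
  rewrite ?vE ?andbT//.
1-3: by rewrite all_cat -IHa -IHb; case: (v a); case: (v b).
all: by rewrite -IHa; case: (v a).
Qed.

Lemma isSome_val_sub a s : {subset var a <= s} ->
  all (fun x => isSome (v (Var x))) s -> isSome (v a).
Proof. by rewrite isSome_val => sub /allP ds; apply/allP => x /sub/ds. Qed.

Lemma designated_some (x : R) : designated (Some x : sharp R) -> x = alg1.
Proof. by case=> [[]|]. Qed.

(** If no letter has value [omega], both sides of the axiom have equal values, except in A3 and A11,
    where the order is used. *)
Lemma axiom_designated a : axiom a -> designated (v a).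
Proof.
have refl1 x y : x = y -> imp x y = alg1 :> R.
  by move=> ->; exact: pr_impxx.
case=> {a} [a|a|a b|a b|a b c|a b c|a b|a b|a|a|a|a b|a b|a b]; rewrite !vE;
  case: (v a) => [x|]; try (by right);
  try (case: (v b) => [y|]; try (by right));
  try (case: (v c) => [z|]; try (by right)); left; congr Some => /=.
- by apply: refl1; rewrite (qb_negK prR).
- by apply: refl1; rewrite (qb_negK prR).
- by apply/(pr_impP prR); rewrite -(qb_meetA prR) (pr_meetxx prR).
- by apply: refl1; rewrite (qb_meetC prR).
- by apply: refl1; rewrite (qb_distr prR).
- by apply: refl1; rewrite (qb_distr prR).
- by apply: refl1; rewrite -(qb_neg_join prR) (qb_negK prR).
- by apply: refl1; rewrite -(qb_neg_join prR) (qb_negK prR).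
- by apply: refl1; rewrite (pr_clo prR).
- by apply: refl1; rewrite (pr_clo prR).
- exact: pr_int_le.
- by apply: refl1; rewrite (pr_int_meet prR).
- by apply: refl1; rewrite (pr_imp prR).
- by apply: refl1; rewrite (pr_imp prR).
Qed.

Lemma rule_designated ps a : rule ps a ->
  (forall p, p \in ps -> designated (v p)) -> designated (v a).
Proof.
have hd p qs : (forall q, q \in p :: qs -> designated (v q)) ->
    designated (v p) /\ (forall q, q \in qs -> designated (v q)).
  by move=> h; split=> [|q qqs]; apply: h; rewrite inE ?eqxx ?qqs ?orbT.
case=> {ps a} [a b sub|a b c sub|a b|a b|a b c|a b c d|a b|a|a b].
- move=> /hd[+ /hd[+ _]]; rewrite vE.
  case vb: (v b) => [y|]; last by right.
  (* This excludes [v a = None], where both premises would be designated whatever [y] is. *)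
  have := isSome_val_sub sub; rewrite -isSome_val vb => /(_ isT).
  case: (v a) => // x _ /designated_some -> /designated_some.
  by move=> /(pr_imp1x prR) ->; left.
- move=> /hd[+ /hd[+ _]]; rewrite !vE.
  (* Likewise the middle formula cannot be [omega] when both outer ones lie in [R]. *)
  have := isSome_val_sub sub; rewrite all_cat -!isSome_val.
  case: (v a) => [x|]; last by right.
  case: (v c) => [z|]; last by right.
  move=> /(_ isT); case: (v b) => //= y _ /designated_some xy.
  by move=> /designated_some /(pr_imp_trans prR xy) xz; left; congr Some.
(* From R3 on, every variable of a premise occurs in the conclusion, so no side condition is
   needed. *)
- move=> /hd[+ _]; rewrite vE.
  case: (v a) => [x|]; case: (v b) => [y|]; try by right.
  move=> /designated_some -> /=; left; congr Some.
  by apply/(pr_impP prR); rewrite (qb_top prR).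
- move=> /hd[+ _]; rewrite !vE.
  case: (v a) => [x|]; case: (v b) => [y|]; try by right.
  move=> /designated_some/(pr_impP prR) xy; left; congr Some.
  exact/(pr_impP prR)/(pr_neg_anti prR).
- move=> /hd[+ /hd[+ _]]; rewrite !vE.
  case: (v a) => [x|]; case: (v b) => [y|]; case: (v c) => [z|]; try by right.
  move=> /designated_some/(pr_impP prR) xy.
  move=> /designated_some/(pr_impP prR) xz; left; congr Some.
  by apply/(pr_impP prR); rewrite (qb_meetA prR) xy.
- move=> /hd[+ /hd[+ /hd[+ /hd[+ _]]]]; rewrite !vE.
  case: (v a) => [x|]; case: (v b) => [y|]; case: (v c) => [z|];
    case: (v d) => [t|]; try by right.
  (* Equivalent formulas have equal values, which reduces the conclusion to reflexivity. *)
  move=> /designated_some xy /designated_some /(pr_imp_anti prR xy) <-.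
  move=> /designated_some zt /designated_some /(pr_imp_anti prR zt) <-.
  by left; congr Some; exact: pr_impxx.
- move=> /hd[+ _]; rewrite !vE.
  case: (v a) => [x|]; case: (v b) => [y|]; try by right.
  move=> /designated_some/(pr_impP prR) xy; left; congr Some.
  exact/(pr_impP prR)/(pr_int_mono prR).
- move=> /hd[+ _]; rewrite vE; case: (v a) => [x|]; last by right.
  by move=> /designated_some ->; left; congr Some; exact: pr_int1.
- move=> /hd[+ /hd[+ _]]; rewrite !vE.
  case: (v a) => [x|]; case: (v b) => [y|]; try by right.
  move=> /designated_some xy /designated_some xy'; left; congr Some.
  exact: pr_imp_intro.
Qed.

(** Strong induction on the position: the premises of a rule lie in [take i s], hence at positions
    below [i]. *)
Lemma derivation_designated (Sigma : fm -> Prop) s :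
  (forall a, Sigma a -> designated (v a)) -> derivation Sigma s ->
  forall i, i < size s -> designated (v (nth Zero s i)).
Proof.
move=> hSigma ds; elim/ltn_ind => i IH ilt.
case: (ds i ilt) => [/axiom_designated//|/hSigma//|[ps sub r]].
apply: (rule_designated r) => p /sub /(nthP Zero)[j].
rewrite size_take ilt => ji; rewrite nth_take// => <-.
exact/IH/(ltn_trans ji).
Qed.

End Valuation.

Theorem theorem4p28 (Sigma : fm -> Prop) (alpha : fm) :
  HPRLre_derives Sigma alpha -> PPRL_entails Sigma alpha.
Proof.
move=> [s ds] R prR v hv hSigma.
(* The last entry of [rcons s alpha] has index [size s]. *)
have := derivation_designated prR hv hSigma ds (i := size s).
by rewrite size_rcons nth_rcons ltnn eqxx; apply.
Qed.
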